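(* Let $n\ge 1$, $M\ge 2$ be integers, let $\sigma>0$, and consider the linear regression model $Y=X\theta^*+W$, where $X$ is a deterministic $n\times M$ real matrix, $\theta^*\in\mathbb{R}^M$, and $W=(W_1,\dots,W_n)^T$ with $W_1,\dots,W_n$ i.i.d. $\mathcal{N}(0,\sigma^2)$. Let $\hat\Theta$ be either the set $\hat\Theta^L$ of all Lasso solutions or the set $\hat\Theta^D$ of all Dantzig solutions with tuning parameter $r=A\sigma\sqrt{(\log M)/n}$, where $A>2\sqrt{2}$; set $c_0=3$ if $\hat\Theta=\hat\Theta^L$ and $c_0=1$ if $\hat\Theta=\hat\Theta^D$. Assume that the Gram matrix $\Psi=\frac1n X^TX$ satisfies $\Psi_{j,j}=1$ for all $1\le j\le M$ and $$\max_{i\ne j}|\Psi_{i,j}|\le \frac{1}{\alpha(1+2c_0)s}$$ for some integer $s\ge 1$ and some constant $\alpha>1$. If $M(\theta^* )\le s$, then $$\mathbb{P}\left(\sup_{\hat\theta\in\hat\Theta}|\hat\theta-\theta^*|_\infty\le c_2 r\right)\ge 1-M^{1-A^2/8},\qquad\text{where } c_2=\frac32\left(1+\frac{(1+c_0)^2}{(1+2c_0)(\alpha-1)}\right).$$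
   Context: For $z\in\mathbb{R}^d$, $|z|_p=(\sum_j|z_j|^p)^{1/p}$ for $1\le p<\infty$ and $|z|_\infty=\max_j|z_j|$. For $\theta\in\mathbb{R}^M$, $J(\theta)=\{j:\theta_j\ne 0\}$ and $M(\theta)=|J(\theta)|$ is the number of non-zero coordinates of $\theta$. For $r>0$, the Lasso solution set $\hat\Theta^L$ is the set of all minimizers over $\theta\in\mathbb{R}^M$ of $\frac1n|Y-X\theta|_2^2+2r|\theta|_1$. The Dantzig solution set $\hat\Theta^D$ is the set of all minimizers of $|\theta|_1$ over those $\theta\in\mathbb{R}^M$ satisfying $\left|\frac1n X^T(Y-X\theta)\right|_\infty\le r$. Neither solution set is assumed to be a singleton, and $M$ may exceed $n$. *)

(* Defs.v *)
From HB Require Import structures.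
From mathcomp Require Import all_boot all_order all_algebra.
From mathcomp Require Import all_classical all_reals all_analysis.

Set Implicit Arguments.
Unset Strict Implicit.
Unset Printing Implicit Defensive.

Import Order.TTheory GRing.Theory Num.Theory.
Import numFieldNormedType.Exports.

Local Open Scope classical_set_scope.
Local Open Scope ring_scope.

(* [lpnorm p] is meant for finite p >= 1; the sup-norm is the canonical norm
   `|z| of the normed module of matrices. *)
Definition lpnorm (R : realType) (d : nat) (p : R) (z : 'cV[R]_d) : R :=
  (\sum_(j < d) `|z j ord0| `^ p) `^ p^-1.

Definition support (R : realType) (M : nat) (theta : 'cV[R]_M) : {set 'I_M} :=
  [set j | theta j ord0 != 0]%SET.

Definition nb_nonzero (R : realType) (M : nat) (theta : 'cV[R]_M) : nat :=
  #|support theta|.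

Definition minimizers (R : realType) (T : Type) (D : set T) (f : T -> R) : set T :=
  [set x | D x /\ forall y, D y -> f x <= f y].

Definition lasso (R : realType) (n M : nat) (X : 'M[R]_(n, M)) (Y : 'cV[R]_n)
    (r : R) : set 'cV[R]_M :=
  minimizers setT
    (fun theta => n%:R^-1 * lpnorm 2 (Y - X *m theta) ^+ 2
                  + 2 * r * lpnorm 1 theta).

Definition dantzig (R : realType) (n M : nat) (X : 'M[R]_(n, M)) (Y : 'cV[R]_n)
    (r : R) : set 'cV[R]_M :=
  minimizers [set theta | `|n%:R^-1 *: (X^T *m (Y - X *m theta))| <= r]
    (fun theta => lpnorm 1 theta).

Inductive estimator := Lasso | Dantzig.

Definition solutions (R : realType) (n M : nat) (e : estimator)
    (X : 'M[R]_(n, M)) (Y : 'cV[R]_n) (r : R) : set 'cV[R]_M :=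
  match e with
  | Lasso => lasso X Y r
  | Dantzig => dantzig X Y r
  end.

Definition cone_const (R : realType) (e : estimator) : R :=
  match e with
  | Lasso => 3
  | Dantzig => 1
  end.

Definition gram (R : realType) (n M : nat) (X : 'M[R]_(n, M)) : 'M[R]_M :=
  n%:R^-1 *: (X^T *m X).

(* The default value 0 does not affect the maximum as soon as M >= 2. *)
Definition max_offdiag (R : realType) (M : nat) (Psi : 'M[R]_M) : R :=
  \big[Num.max/0]_(ij : 'I_M * 'I_M | ij.1 != ij.2) `|Psi ij.1 ij.2|.

Definition mutually_independent (d d' : measure_display)
    (Omega : measurableType d) (S : measurableType d') (R : realType)
    (P : probability Omega R) (I : finType) (Z : I -> {RV P >-> S}) : Prop :=
  forall (K : {set I}) (B : I -> set S),
    (forall i, i \in K -> measurable (B i)) ->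
    P (\bigcap_(i in [set` K]) (Z i @^-1` B i)) =
    (\prod_(i in K) P (Z i @^-1` B i))%E.

(* The laws are compared on Borel sets only: as set functions, both sides also
   take unspecified values on non-measurable sets. The second parameter of
   [normal_prob] is the standard deviation. *)
Definition gaussian_law (d : measure_display) (Omega : measurableType d)
    (R : realType) (P : probability Omega R) (m sigma : R)
    (Z : {RV P >-> R}) : Prop :=
  forall B : set R, measurable B -> distribution P Z B = normal_prob m sigma B.

(* The sup is taken in the extended reals, where it is total; [sup] on R would
   be 0 on an unbounded set. *)
Definition sup_loss (R : realType) (M : nat) (S : set 'cV[R]_M)
    (thetas : 'cV[R]_M) : \bar R :=
  ereal_sup [set (`|theta - thetas|)%:E | theta in S].

(* Main.v *)
Require Import Defs.
From HB Require Import structures.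
From mathcomp Require Import all_boot all_order all_algebra.
From mathcomp Require Import all_classical all_reals all_analysis.
From mathcomp Require Import measurable_realfun ring lra.

(* Let [h = theta - thetas] for a solution [theta]. On the event that every
   coordinate of [X^T W / n] is at most [r / 2] in absolute value, all coordinates
   of [Psi h] are at most [3 r / 2], and the l^1-mass of [h] off the support of
   [thetas] is at most [c0] times its mass on the support; with the coherence
   bound this controls [|h|_oo]. Each coordinate of [X^T W / n] is a normal
   variable of variance [sigma ^ 2 / n], because [Psi] has unit diagonal, so the
   union bound over the [M] coordinates and the tail bound
   [P (|Z| > t) <= exp (- t ^ 2 / (2 Var Z))], without a factor 2, give the
   probability of that event.

   The probability of a non-measurable set is unspecified, so measurability of the
   event in the conclusion has to be proved: the events that the objective takes a
   value at most [q] on a given closed set are projections, along a compact set, of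
   closed sets, and the event is a countable Boolean combination of these. *)

Set Implicit Arguments.
Unset Strict Implicit.
Unset Printing Implicit Defensive.

Import Order.TTheory GRing.Theory Num.Theory.
Import numFieldNormedType.Exports.

Local Open Scope classical_set_scope.
Local Open Scope ring_scope.

(** * Deterministic estimate: optimality conditions, cone condition and mutual coherence *)

Section Deterministic.
Context {R : realType}.

Lemma lpnorm1E (d : nat) (z : 'cV[R]_d) : lpnorm 1 z = \sum_j `|z j ord0|.
Proof.
rewrite /lpnorm invr1 powRr1; last by apply: sumr_ge0 => j _; rewrite powR_ge0.
by apply: eq_bigr => j _; rewrite powRr1.
Qed.

Lemma lpnorm2_sqrE (d : nat) (z : 'cV[R]_d) :
  lpnorm 2 z ^+ 2 = \sum_j z j ord0 ^+ 2.
Proof.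
rewrite /lpnorm -powR_mulrn ?powR_ge0// -powRrM mulVf ?pnatr_eq0// powRr1.
  by apply: eq_bigr => j _; rewrite powR_mulrn// real_normK ?num_real.
by apply: sumr_ge0 => j _; rewrite powR_ge0.
Qed.

(** A form of the squared Euclidean norm free of real powers, suited to algebra and to continuity
    arguments. *)
Definition sqnorm (d : nat) (z : 'cV[R]_d) : R := \sum_j z j ord0 ^+ 2.

Definition l1norm (d : nat) (z : 'cV[R]_d) : R := \sum_j `|z j ord0|.

Lemma lasso_min (n M : nat) (X : 'M[R]_(n, M)) (Y : 'cV[R]_n) (r : R)
    (theta : 'cV[R]_M) : lasso X Y r theta <-> forall eta : 'cV[R]_M,
  n%:R^-1 * sqnorm (Y - X *m theta) + 2 * r * l1norm theta <=
  n%:R^-1 * sqnorm (Y - X *m eta) + 2 * r * l1norm eta.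
Proof.
have E (eta : 'cV[R]_M) : n%:R^-1 * sqnorm (Y - X *m eta) + 2 * r * l1norm eta
    = n%:R^-1 * lpnorm 2 (Y - X *m eta) ^+ 2 + 2 * r * lpnorm 1 eta.
  by congr (_ * _ + _ * _); [rewrite lpnorm2_sqrE|rewrite lpnorm1E].
split => [[_ h] eta|h]; first by rewrite (E theta) (E eta); exact: h.
by split; [exact: I|move=> eta _; move: (h eta); rewrite (E theta) (E eta)].
Qed.

Lemma cV_norm_leP (d : nat) (z : 'cV[R]_d) (c : R) : 0 <= c ->
  (`|z| <= c) <-> (forall j, `|z j ord0| <= c).
Proof.
have -> : `|z| = \big[Num.max/0]_ij `|z ij.1 ij.2| by exact: mx_normrE.
move=> c0; split => [/bigmax_leP[_ h] j|h].
  exact: (h (j, ord0)).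
by apply/bigmax_leP; split => // -[i j] _ /=; rewrite ord1.
Qed.

(** At the residual this is minus half the gradient of the quadratic loss, the vector constrained by
    the Dantzig selector; at the noise it is the vector that has to be small. *)
Definition correlation (n M : nat) (X : 'M[R]_(n, M)) (u : 'cV[R]_n) : 'cV[R]_M :=
  n%:R^-1 *: (X^T *m u).

(** Serves twice: with [u] the residual and [h] a perturbation of one coordinate, and with [u] the
    noise and [h] the estimation error. *)
Lemma sqnorm_sub (n M : nat) (X : 'M[R]_(n, M)) (u : 'cV[R]_n)
    (h : 'cV[R]_M) :
  n%:R^-1 * sqnorm (u - X *m h) = n%:R^-1 * sqnorm u
    - 2 * \sum_j correlation X u j ord0 * h j ord0
    + n%:R^-1 * sqnorm (X *m h).
Proof.
have -> : \sum_j correlation X u j ord0 * h j ord0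
    = n%:R^-1 * \sum_i u i ord0 * (X *m h) i ord0.
  transitivity (((correlation X u)^T *m h) ord0 ord0).
    by rewrite [RHS]mxE; apply: eq_bigr => j _; rewrite [in RHS]mxE.
  rewrite /correlation linearZ/= trmx_mul trmxK -scalemxAl -mulmxA mxE mxE.
  by congr (_ * _); apply: eq_bigr => j _; rewrite mxE.
set v := X *m h; rewrite /sqnorm.
suff -> : \sum_j (u - v) j ord0 ^+ 2 = \sum_j u j ord0 ^+ 2
    - 2 * (\sum_i u i ord0 * v i ord0) + \sum_j v j ord0 ^+ 2 by ring.
rewrite mulr_sumr -sumrB -big_split/=; apply: eq_bigr => i _.
by rewrite !mxE; ring.
Qed.

Lemma gram_diagE (n M : nat) (X : 'M[R]_(n, M)) (j : 'I_M) :
  gram X j j = n%:R^-1 * \sum_i X i j ^+ 2.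
Proof.
rewrite /gram mxE mxE; congr (_ * _); apply: eq_bigr => i _.
by rewrite mxE expr2.
Qed.

(** First-order optimality, by which Lasso solutions satisfy the Dantzig constraint: moving [theta]
    by [t] along coordinate [j] raises the objective by at most [- 2 t g + t ^ 2 + 2 r |t|], so this
    is nonnegative for every [t]. *)
Lemma lasso_correlation_le (n M : nat) (X : 'M[R]_(n, M)) (Y : 'cV[R]_n) (r : R)
    (theta : 'cV[R]_M) :
  0 <= r -> (forall j, gram X j j = 1) -> lasso X Y r theta ->
  forall j, `|correlation X (Y - X *m theta) j ord0| <= r.
Proof.
move=> r0 diag1 /lasso_min thmin j; set g := correlation _ _ _ _.
have key (t : R) : 0 <= - 2 * (t * g) + t ^+ 2 + 2 * r * `|t|.
  pose e : 'cV[R]_M := t *: delta_mx j ord0.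
  have eE k : e k ord0 = t * (k == j)%:R by rewrite /e !mxE eqxx andbT.
  have := thmin (theta + e).
  rewrite mulmxDr opprD addrA (sqnorm_sub X (Y - X *m theta) e).
  have -> : \sum_k correlation X (Y - X *m theta) k ord0 * e k ord0 = t * g.
    rewrite (bigD1 j)//= big1 ?addr0; last first.
      by move=> k kj; rewrite eE (negPf kj) /= !mulr0.
    by rewrite eE !eqxx/= mulr1 mulrC.
  have -> : n%:R^-1 * sqnorm (X *m e) = t ^+ 2.
    have -> : sqnorm (X *m e) = t ^+ 2 * \sum_i X i j ^+ 2.
      rewrite mulr_sumr; apply: eq_bigr => i _.
      by rewrite -scalemxAr mxE -colE mxE exprMn.
    by rewrite mulrCA -gram_diagE diag1 mulr1.
  have : l1norm (theta + e) <= l1norm theta + `|t|.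
    have -> : `|t| = \sum_k `|e k ord0|.
      rewrite (bigD1 j)//= big1 ?addr0; last first.
        by move=> k kj; rewrite eE (negPf kj) /= mulr0 normr0.
      by rewrite eE !eqxx/= mulr1.
    rewrite /l1norm -big_split/=; apply: ler_sum => k _.
    by rewrite mxE ler_normD.
  have r20 : 0 <= 2 * r by lra.
  by move=> /(ler_wpM2l r20); lra.
rewrite leNgt; apply/negP; have [g0|g0] := ger0P g => rg.
  (* This [t > 0] minimizes the quadratic, with negative value [- (g - r) ^ 2]. The choice [g + r]
     below is its mirror image. *)
  have := key (g - r); rewrite gtr0_norm ?subr_gt0//.
  have : 0 < (g - r) ^+ 2 by rewrite exprn_gt0// subr_gt0.
  by rewrite expr2; lra.
have := key (g + r); rewrite ltr0_norm; last lra.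
have : 0 < (- g - r) ^+ 2 by rewrite exprn_gt0// subr_gt0.
by rewrite expr2; lra.
Qed.

(* Every row of [Psi h] gives [|h_j| <= b + mu |h|_1]. Summing over [J] and using
   the cone condition bounds [|h|_1], since [s mu (1 + c0) < 1]. *)
Lemma mutual_coherence_bound (M s : nat) (Psi : 'M[R]_M) (J : {set 'I_M})
    (h : 'cV[R]_M) (c0 alpha b mu : R) :
  (forall j, Psi j j = 1) ->
  (forall i j, i != j -> `|Psi i j| <= mu) ->
  mu = 1 / (alpha * (1 + 2 * c0) * s%:R) ->
  1 <= c0 -> 1 < alpha -> (1 <= s)%N -> (#|J| <= s)%N ->
  0 <= b ->
  (forall j, `|(Psi *m h) j ord0| <= b) ->
  \sum_(j in ~: J) `|h j ord0| <= c0 * \sum_(j in J) `|h j ord0| ->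
  forall j, `|h j ord0|
     <= b * (1 + (1 + c0) ^+ 2 / ((1 + 2 * c0) * (alpha - 1))).
Proof.
move=> diag1 offd muE c01 alpha1 s1 Js b0 Psih cone j0.
set p := \sum_(j in J) `|h j ord0| in cone *.
set q := \sum_(j in ~: J) `|h j ord0| in cone *.
have sR : 1 <= s%:R :> R by rewrite ler1n.
have den : 0 < alpha * (1 + 2 * c0) by apply: mulr_gt0; lra.
have mu0 : 0 < mu by rewrite muE divr_gt0// mulr_gt0//; lra.
have pq : \sum_j `|h j ord0| = p + q.
  rewrite (bigID (mem J))/= /p /q; congr (_ + _).
  by apply: eq_bigl => j; rewrite inE.
have p0 : 0 <= p by apply: sumr_ge0.
have hle j : `|h j ord0| <= b + mu * (p + q).
  have -> : h j ord0 = (Psi *m h) j ord0 - \sum_(i | i != j) Psi j i * h i ord0.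
    by rewrite [X in _ = X - _]mxE (bigD1 j)//= diag1 mul1r addrK.
  rewrite (le_trans (ler_normB _ _))// lerD// (le_trans (ler_norm_sum _ _ _))//.
  rewrite -pq mulr_sumr [leRHS](bigID (fun i => i != j))/=.
  rewrite (le_trans (ler_sum _ (G := fun i => mu * `|h i ord0|) _))//.
    by move=> i ij; rewrite normrM ler_wpM2r// offd// eq_sym.
  by rewrite lerDl sumr_ge0// => i _; rewrite mulr_ge0// ltW.
have pq1 : p + q <= (1 + c0) * p by lra.
have ple : p <= s%:R * (b + mu * ((1 + c0) * p)).
  apply: (@le_trans _ _ (\sum_(j in J) (b + mu * ((1 + c0) * p)))).
    apply: ler_sum => j _; apply: (le_trans (hle j)).
    by rewrite lerD2l ler_wpM2l// ltW.
  rewrite sumr_const -[leLHS]mulr_natl ler_wpM2r ?ler_nat//.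
  by apply: addr_ge0 => //; apply: mulr_ge0; [exact: ltW|apply: mulr_ge0 => //; lra].
apply: (le_trans (hle j0)); rewrite [leRHS]mulrDr mulr1 lerD2l.
(* The coherence level is calibrated so that [s mu] is the inverse of [D = alpha (1 + 2 c0)]. As
   [D > 1 + c0], the bound of [p] in terms of itself can then be solved for [p]. *)
have smu : s%:R * mu * (alpha * (1 + 2 * c0)) = 1.
  rewrite muE; field; apply/and3P; split; lra.
set D := alpha * (1 + 2 * c0) in den smu.
have D1 : 1 + c0 < D by rewrite /D; nra.
have ple2 : (D - (1 + c0)) * p <= s%:R * b * D.
  have := ler_wpM2l (ltW den) ple.
  have -> : D * (s%:R * (b + mu * ((1 + c0) * p)))
     = s%:R * b * D + (s%:R * mu * D) * (1 + c0) * p by ring.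
  by rewrite smu; lra.
have mup : mu * (p + q) * (D - (1 + c0)) <= b * (1 + c0).
  apply: (@le_trans _ _ (mu * (1 + c0) * ((D - (1 + c0)) * p))).
    rewrite mulrAC -!mulrA ler_wpM2l ?(ltW mu0)// mulrCA.
    by rewrite ler_wpM2l//; lra.
  apply: (@le_trans _ _ (mu * (1 + c0) * (s%:R * b * D))).
    by rewrite ler_wpM2l// mulr_ge0// ?(ltW mu0)//; lra.
  have -> : mu * (1 + c0) * (s%:R * b * D) = (s%:R * mu * D) * (b * (1 + c0)) by ring.
  by rewrite smu mul1r.
have E0 : 0 < (1 + 2 * c0) * (alpha - 1) by apply: mulr_gt0; lra.
rewrite mulrA ler_pdivlMr//.
(* Trades the denominator [D - (1 + c0)] for [(1 + 2 c0) (alpha - 1)] at the cost of a second factor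
   [1 + c0], whence the square in the constant. The two sides differ by [c0 (D - c0)]. *)
have E1 : (1 + 2 * c0) * (alpha - 1) <= (1 + c0) * (D - (1 + c0)).
  by rewrite /D; nra.
have muq : 0 <= mu * (p + q).
  by rewrite mulr_ge0 ?(ltW mu0)// -pq sumr_ge0.
apply: (le_trans (ler_wpM2l muq E1)).
have c11 : 0 <= 1 + c0 by lra.
by have := ler_wpM2l c11 mup; rewrite !expr2; lra.
Qed.

Lemma correlation_residual (n M : nat) (X : 'M[R]_(n, M)) (thetas theta : 'cV[R]_M)
    (u : 'cV[R]_n) :
  correlation X (X *m thetas + u - X *m theta)
  = correlation X u - gram X *m (theta - thetas).
Proof.
rewrite /correlation /gram -scalemxAl -mulmxA -scalerBr; congr (_ *: _).
by rewrite !mulmxBr mulmxDr opprB [RHS]addrCA addrA.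
Qed.

Lemma dantzig_min (n M : nat) (X : 'M[R]_(n, M)) (Y : 'cV[R]_n) (r : R)
    (theta : 'cV[R]_M) : dantzig X Y r theta ->
  `|correlation X (Y - X *m theta)| <= r /\
  forall eta : 'cV[R]_M, `|correlation X (Y - X *m eta)| <= r ->
    l1norm theta <= l1norm eta.
Proof.
move=> [feas h]; split => // eta /h.
by rewrite (lpnorm1E theta) (lpnorm1E eta).
Qed.

(** On the support this is the reverse triangle inequality; off it [thetas] vanishes, so the terms
    of the difference are exactly [- |theta_j|]. *)
Lemma l1norm_sub_support (M : nat) (thetas theta : 'cV[R]_M) :
  l1norm thetas - l1norm theta <=
  \sum_(j in Defs.support thetas) `|(theta - thetas) j ord0|
  - \sum_(j in ~: Defs.support thetas) `|(theta - thetas) j ord0|.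
Proof.
have -> : \sum_(j in ~: Defs.support thetas) `|(theta - thetas) j ord0|
    = \sum_(j | j \notin Defs.support thetas) `|(theta - thetas) j ord0|.
  by apply: eq_bigl => j; rewrite inE.
rewrite /l1norm -sumrB (bigID (mem (Defs.support thetas)))/= -sumrN.
apply: lerD; apply: ler_sum => j.
  by move=> _; rewrite !mxE distrC lerB_dist.
rewrite inE negbK => /eqP thetasj0.
by rewrite !mxE thetasj0 subr0 normr0 sub0r.
Qed.

Lemma solutions_close (n M : nat) (X : 'M[R]_(n, M)) (thetas theta : 'cV[R]_M)
    (u : 'cV[R]_n) (e : estimator) (r alpha : R) (s : nat) :
  let c0 : R := cone_const R e in
  0 < r -> 1 < alpha -> (1 <= s)%N ->
  (forall j, gram X j j = 1) ->
  max_offdiag (gram X) <= 1 / (alpha * (1 + 2 * c0) * s%:R) ->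
  (nb_nonzero thetas <= s)%N ->
  (forall j, `|correlation X u j ord0| <= r / 2) ->
  solutions e X (X *m thetas + u) r theta ->
  `|theta - thetas|
    <= 3 / 2 * (1 + (1 + c0) ^+ 2 / ((1 + 2 * c0) * (alpha - 1))) * r.
Proof.
move=> c0 r0 alpha1 s1 diag1 offdiag Js noise sol.
set h := theta - thetas.
have c01 : 1 <= c0 by rewrite /c0; case: (e) => /=; lra.
have offd (i j : 'I_M) : i != j ->
    `|gram X i j| <= 1 / (alpha * (1 + 2 * c0) * s%:R).
  move: offdiag => /bigmax_leP[_ H] ij; exact: (H (i, j)).
have residual (j : 'I_M) : (gram X *m h) j ord0 = correlation X u j ord0
    - correlation X (X *m thetas + u - X *m theta) j ord0.
  have subE (a b : 'cV[R]_M) : (a - b) j ord0 = a j ord0 - b j ord0 by rewrite !mxE.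
  by rewrite correlation_residual subE subKr.
have score (j : 'I_M) : `|correlation X (X *m thetas + u - X *m theta) j ord0| <= r.
  case: (e) sol => /= [/(lasso_correlation_le (ltW r0) diag1)//|].
  by move=> /dantzig_min[/cV_norm_leP-/(_ (ltW r0))].
(* At most [r / 2] from the noise and [r] from the residual: the origin of the factor 3/2. *)
have gramh (j : 'I_M) : `|(gram X *m h) j ord0| <= 3 / 2 * r.
  rewrite residual (le_trans (ler_normB _ _))//; have := noise j.
  by have := score j; lra.
have noiseE : X *m thetas + u - X *m thetas = u by rewrite addrAC subrr add0r.
have cone : \sum_(j in ~: Defs.support thetas) `|h j ord0|
    <= c0 * \sum_(j in Defs.support thetas) `|h j ord0|.
  have := l1norm_sub_support thetas theta; rewrite -/h.
  (* Lasso: with [p] and [q] the masses of [h] on and off the support, comparison with [thetas]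
     gives [2 r (q - p) <= r (p + q)] once the nonnegative prediction term is dropped, hence
     [q <= 3 p]. *)
  rewrite /c0; case: (e) sol => /= [/lasso_min/(_ thetas)|].
    rewrite noiseE.
    have -> : X *m thetas + u - X *m theta = u - X *m h.
      by rewrite mulmxBr opprB [RHS]addrCA addrA.
    rewrite (sqnorm_sub X u h).
    have : 0 <= n%:R^-1 * sqnorm (X *m h).
      by rewrite mulr_ge0// sumr_ge0// => i _; rewrite sqr_ge0.
    have : \sum_j correlation X u j ord0 * h j ord0 <= r / 2 * \sum_j `|h j ord0|.
      rewrite mulr_sumr; apply: ler_sum => j _.
      rewrite (le_trans (ler_norm _))// normrM ler_wpM2r//.
    have -> : \sum_j `|h j ord0| = \sum_(j in Defs.support thetas) `|h j ord0|
        + \sum_(j in ~: Defs.support thetas) `|h j ord0|.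
      rewrite (bigID (mem (Defs.support thetas)))/=; congr (_ + _).
      by apply: eq_bigl => j; rewrite finset.in_setC.
    set p := \sum_(j in Defs.support thetas) `|h j ord0|.
    set q := \sum_(j in ~: Defs.support thetas) `|h j ord0|.
    move=> h1 h2 h3 h4; rewrite -(ler_pM2l r0).
    have := ler_wpM2l (ltW r0) h4; lra.
  (* Dantzig: the noise bound makes [thetas] feasible, so the l^1-norm of [theta] is no larger and
     [q <= p]. *)
  move=> /dantzig_min[_ /(_ thetas)].
  rewrite noiseE => H; have : l1norm theta <= l1norm thetas.
    apply: H; apply/cV_norm_leP; first exact: ltW.
    by move=> j; rewrite (le_trans (noise j))//; lra.
  by lra.
have r32 : 0 <= 3 / 2 * r by lra.
apply/cV_norm_leP => [|j].
  apply: mulr_ge0; last exact: ltW.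
  apply: mulr_ge0; first lra.
  apply: addr_ge0 => //; apply: divr_ge0; first exact: sqr_ge0.
  by apply: mulr_ge0; lra.
rewrite mulrAC.
exact: (mutual_coherence_bound diag1 offd erefl c01 alpha1 s1 Js r32 gramh cone).
Qed.

End Deterministic.

(** * Measurability, in a parameter, of minimizers avoiding a closed set *)

Section Projection.
Context {T U : topologicalType}.

(** Tube lemma: if no point of [K] lies over [t], compactness of [K] yields one neighbourhood of [t]
    that serves all of [K] at once, so the complement of the projection is open. *)
Lemma closed_projection (K : set U) (C : set (T * U)) :
  compact K -> closed C -> closed [set t | exists2 u, K u & C (t, u)].
Proof.
move=> /compact_near_coveringP cK cC; rewrite -openC openE => t nt /=.
have : \forall t' \near t, K `<=` [set u | ~ C (t', u)].
  apply: cK => u Ku.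
  have : nbhs (t, u) (~` C).
    apply: open_nbhs_nbhs; split; first exact: closed_openC.
    by move=> Ctu; apply: nt; exists u.
  case=> -[A B] /= [tA uB] AB; exists (B, A) => //= -[u' t'] /= [Bu' At'].
  exact: (AB (t', u')).
by apply: filterS => t' h [u Ku Ctu]; exact: h Ctu.
Qed.

Context {R : realType}.
Variables (D : set (T * U)) (f : T * U -> R).
Hypothesis closedD : closed D.
Hypothesis cont_f : continuous f.
(** Coercivity uniform in the parameter: [K] depends on the level [q] only, so that sublevel sets
    project along a fixed compact set. *)
Hypothesis proper_f : forall q : R, exists2 K : set U, compact K &
  forall t u, D (t, u) -> f (t, u) <= q -> K u.

Let sublevel (G : set U) (q : R) : set T :=
  [set t | exists u, [/\ G u, D (t, u) & f (t, u) <= q]].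

Let closed_fle (q : R) : closed [set tu | f tu <= q].
Proof. by apply: (@closed_comp _ _ f [set x | x <= q]) => // tu _; exact: cont_f. Qed.

Let closed_sublevel (G : set U) (q : R) : closed G -> closed (sublevel G q).
Proof.
move=> cG; have [K cK KP] := proper_f q.
rewrite (_ : sublevel G q = [set t | exists2 u, K u &
    ((snd @^-1` G) `&` (D `&` [set tu | f tu <= q])) (t, u)]).
  apply: closed_projection => //; apply: closedI.
    by apply: closed_comp => // tu _; exact: cvg_snd.
  exact: closedI.
apply/seteqP; split => t /=.
  by case=> u [Gu Dtu fq]; exists u => //; exact: KP fq.
by case=> u Ku [Gu [Dtu fq]]; exists u.
Qed.

(* Minimizers avoid [G] exactly when the infimum over [G] exceeds the infimum,
   which a rational level witnesses. *)
Let no_minimizerE (G : set U) : closed G ->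
  [set t | forall u, minimizers [set u | D (t, u)] (fun u => f (t, u)) u -> ~ G u]
  = (\bigcap_(q : rat) ~` sublevel setT (ratr q))
    `|` (\bigcup_(q : rat) (sublevel setT (ratr q) `&` ~` sublevel G (ratr q))).
Proof.
move=> cG; apply/seteqP; split => t /=; last first.
  case=> [nf u [Dtu _] _|[q _ [[v [_ Dtv fvq]] nG]] u [Dtu umin] Gu].
    (* A feasible point would have its value below some rational level; here no level is reached, so
       there is no minimizer. *)
    have ltf : f (t, u) < f (t, u) + 1 by rewrite ltrDl.
    have [q /itvP fq] := rat_in_itvoo ltf.
    by apply: (nf q I); exists u; split => //; rewrite ltW// fq.
  by apply: nG; exists u; split => //; exact: le_trans (umin _ Dtv) fvq.
move=> nmin; apply: contrapT => /not_orP[/existsNP[q0 /not_implyP[_ /contrapT]]] + noq.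
have sub_le (q : rat) : sublevel setT (ratr q) t -> sublevel G (ratr q) t.
  by move=> qT; apply: contrapT => qG; apply: noq; exists q.
move=> /sub_le[u0 [Gu0 Dtu0 fu0]]; have [K cK KP] := proper_f (ratr q0).
(* Cutting at a level already reached on [G] leaves a nonempty compact set of candidates, on which
   the objective attains its minimum. *)
pose C : set U := [set u | [/\ G u, D (t, u) & f (t, u) <= ratr q0]].
have cont_pair : continuous (fun u : U => (t, u)).
  by move=> u; apply: cvg_pair; [exact: cvg_cst|exact: cvg_id].
have cC : compact C.
  apply: (subclosed_compact _ cK) => [|u [_ Dtu]]; last exact: KP.
  rewrite (_ : C = G `&` ((pair t) @^-1` (D `&` [set tu | f tu <= ratr q0]))).
    apply: closedI => //; apply: closed_comp => [u _|]; first exact: cont_pair.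
    exact: closedI.
  by apply/seteqP; split => u [Gu]; [|case]; do ?split.
have [] := @compact_EVT_min U R (fun u => f (t, u)) C _ cC.
- by exists u0; split.
- apply: continuous_subspaceT => u.
  by apply: (@continuous_comp _ _ _ (pair t) f); [exact: cont_pair|exact: cont_f].
move=> u1; rewrite inE => -[Gu1 Dtu1 fu1] u1min; apply: (nmin u1) => //.
split=> // v Dtv; rewrite leNgt; apply/negP => fvu1.
(* A feasible [v] strictly below the minimum over [C] leaves room for a rational level, which by
   [sub_le] is reached on [G] and therefore in [C], a contradiction. *)
have [q /itvP fq] := rat_in_itvoo fvu1.
have [u [Gu Dtu fu]] : sublevel G (ratr q) t.
  by apply: sub_le; exists v; split => //; rewrite ltW// fq.
have fuu1 : f (t, u) < f (t, u1) by rewrite (le_lt_trans fu)// fq.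
have : u \in C by rewrite inE; split => //; rewrite (le_trans (ltW fuu1)).
by move=> /u1min; rewrite leNgt fuu1.
Qed.

(** Pulls the countable decomposition back along [Y]. Measurability of [Y] is expressed by preimages
    of open sets, [T] being a topological space. *)
Lemma measurable_no_minimizer (d : measure_display) (Omega : measurableType d)
    (Y : Omega -> T) (G : set U) :
  (forall O, open O -> measurable (Y @^-1` O)) -> closed G ->
  measurable [set w | forall u,
    minimizers [set u | D (Y w, u)] (fun u => f (Y w, u)) u -> ~ G u].
Proof.
move=> mY cG.
have mS (H : set U) (q : R) : closed H -> measurable (Y @^-1` sublevel H q).
  move=> cH; rewrite -[Y @^-1` _]setCK; apply: measurableC.
  by rewrite preimage_setC; apply: mY; rewrite openC; exact: closed_sublevel.
rewrite (_ : [set w | _] = Y @^-1` [set t | forall u,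
  minimizers [set u | D (t, u)] (fun u => f (t, u)) u -> ~ G u])//.
rewrite no_minimizerE// preimage_setU preimage_bigcap preimage_bigcup.
apply: measurableU.
  rewrite -[X in measurable X]setCK setC_bigcap; apply: measurableC.
  apply: bigcupT_measurable_rat => q; rewrite -preimage_setC setCK; exact: mS.
apply: bigcupT_measurable_rat => q; rewrite preimage_setI -preimage_setC.
by apply: measurableI; [exact: mS|apply: measurableC; exact: mS].
Qed.

End Projection.

(** * Topology and measurability for column vectors *)

Section MatrixMeasurability.
Context {R : realType}.

(** An open set is a countable union of cubes with rational centers and radii [1 / (k + 1)], and the
    preimage of a cube is a finite intersection of coordinate preimages. *)
Lemma measurable_cV_preimage (d : measure_display) (Omega : measurableType d)
    (n : nat) (Y : Omega -> 'cV[R]_n) :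
  (forall i, measurable_fun setT (fun w => Y w i ord0)) ->
  forall O : set 'cV[R]_n, open O -> measurable (Y @^-1` O).
Proof.
move=> mY O oO.
pose center (p : 'cV[rat]_n * nat) : 'cV[R]_n := map_mx ratr p.1.
pose cube (p : 'cV[rat]_n * nat) : set 'cV[R]_n := ball (center p) p.2.+1%:R^-1.
have mcube p : measurable (Y @^-1` cube p).
  rewrite (_ : Y @^-1` cube p = \bigcap_(i : 'I_n)
      ((fun w => Y w i ord0) @^-1` ball (center p i ord0) p.2.+1%:R^-1)).
    apply: fin_bigcap_measurable => [|i _]; first exact: finite_finset.
    by rewrite -[X in measurable X]setTI; apply: mY => //; exact: measurable_ball.
  apply/seteqP; split => w /=; first by move=> [_ h] i _; exact: h.
  move=> h; split; first by rewrite invr_gt0.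
  by move=> i j; rewrite ord1; exact: h.
rewrite (_ : Y @^-1` O = \bigcup_(p in [set p | cube p `<=` O]) (Y @^-1` cube p)).
  rewrite bigcup_mkcond; apply: countable_bigcupT_measurable => // p.
  by case: ifP => // _; exact: mcube.
apply/seteqP; split => w /=; last by case=> p; exact.
move: oO; rewrite openE => /(_ _)/[apply].
move=> /nbhs_ballP[eps /= eps0 epsO].
(* A cube of radius below [eps / 2] that contains [Y w] stays within [eps] of [Y w]. *)
have [k _ kP] := near_infty_natSinv_lt (PosNum (divr_gt0 eps0 (ltr0n R 2))).
have k0 : 0 < k.+1%:R^-1 :> R by rewrite invr_gt0.
have k_lt : k.+1%:R^-1 < eps / 2 by exact: (kP k (leqnn k)).
have q_ex (i : 'I_n) : exists q : rat, `|Y w i ord0 - ratr q| < k.+1%:R^-1.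
  have lt2 : Y w i ord0 - k.+1%:R^-1 < Y w i ord0 + k.+1%:R^-1.
    by rewrite ltrBlDr -addrA ltrDl addr_gt0.
  by have [q /itvP qP] := rat_in_itvoo lt2; exists q; rewrite distrC ltr_distl !qP.
pose p : 'cV[rat]_n * nat := (\col_i projT1 (cid (q_ex i)), k).
have Yp : cube p (Y w).
  split=> // i j; rewrite ord1 /center /= !mxE; case: cid => q qP /=.
  by rewrite /ball/= distrC.
exists p => // z [_ zp]; apply: epsO; split => // i j.
have [_ /(_ i j) Ypij] := Yp.
rewrite (splitr eps); apply: (@ball_triangle _ _ (center p i j)).
  by apply: ball_sym; apply: le_ball Ypij; exact: ltW.
by apply: le_ball (zp i j); exact: ltW.
Qed.

(** Transported by transposition from a box of row vectors, a product of segments. *)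
Lemma compact_cV_box (M : nat) (q : R) :
  compact [set z : 'cV[R]_M | forall j, `|z j ord0| <= q].
Proof.
have tr_cont : continuous (@trmx R 1 M).
  move=> v B [P vP PB]; exists (fun i j => P j i) => [i j|u uP].
    by have := vP j i; rewrite mxE.
  by apply: PB => i j; rewrite mxE; exact: uP.
rewrite (_ : [set z | _] = @trmx R 1 M @`
    [set v : 'rV[R]_M | forall i, `[- q, q]%classic (v ord0 i)]).
  apply: continuous_compact; first exact: continuous_subspaceT.
  by apply: (@rV_compact _ _ (fun=> `[- q, q]%classic)) => _; exact: segment_compact.
apply/seteqP; split => z /=.
  move=> zq; exists z^T; last exact: trmxK.
  by move=> j; rewrite mxE in_itv/= -ler_norml.
by case=> v vq <- j; rewrite mxE ler_norml; have := vq j; rewrite in_itv.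
Qed.

Lemma continuous_sum (T : topologicalType) (I : finType) (F : I -> T -> R) :
  (forall i, continuous (F i)) -> continuous (fun t => \sum_i F i t).
Proof.
move=> cF; elim: (index_enum I) => [|i s IH].
  by under eq_fun do rewrite big_nil; move=> t; exact: cvg_cst.
under eq_fun do rewrite big_cons; move=> t.
by apply: cvgD; [exact: cF|exact: IH].
Qed.

End MatrixMeasurability.

(** * Measurability of the event that all solutions are close to the true parameter *)

Section EventMeasurability.
Context {R : realType}.

Lemma continuous_fst_coord (n M : nat) (i : 'I_n) :
  continuous (fun p : 'cV[R]_n * 'cV[R]_M => p.1 i ord0).
Proof.
move=> p; apply: (@continuous_comp _ _ _ fst (fun z : 'cV[R]_n => z i ord0)).
  exact: cvg_fst.
exact: coord_continuous.
Qed.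

Lemma continuous_snd_coord (n M : nat) (j : 'I_M) :
  continuous (fun p : 'cV[R]_n * 'cV[R]_M => p.2 j ord0).
Proof.
move=> p; apply: (@continuous_comp _ _ _ snd (fun z : 'cV[R]_M => z j ord0)).
  exact: cvg_snd.
exact: coord_continuous.
Qed.

Lemma continuous_residual (n M : nat) (X : 'M[R]_(n, M)) (i : 'I_n) :
  continuous (fun p : 'cV[R]_n * 'cV[R]_M => (p.1 - X *m p.2) i ord0).
Proof.
rewrite (_ : (fun _ => _) = (fun p : 'cV[R]_n * 'cV[R]_M =>
    p.1 i ord0 - \sum_k X i k * p.2 k ord0)).
  move=> p; apply: cvgB; first exact: continuous_fst_coord.
  apply: (@continuous_sum R _ _ (fun k (p : 'cV[R]_n * 'cV[R]_M) =>
    X i k * p.2 k ord0)) => k q.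
  by apply: cvgM; [exact: cvg_cst|exact: continuous_snd_coord].
by apply/funext => p; rewrite !mxE.
Qed.

Lemma continuous_correlation (n M : nat) (X : 'M[R]_(n, M)) (j : 'I_M) :
  continuous (fun p : 'cV[R]_n * 'cV[R]_M =>
    correlation X (p.1 - X *m p.2) j ord0).
Proof.
rewrite (_ : (fun _ => _) = (fun p : 'cV[R]_n * 'cV[R]_M =>
    n%:R^-1 * \sum_i X i j * (p.1 - X *m p.2) i ord0)).
  move=> p; apply: cvgM; first exact: cvg_cst.
  apply: (@continuous_sum R _ _ (fun i (p : 'cV[R]_n * 'cV[R]_M) =>
    X i j * (p.1 - X *m p.2) i ord0)) => i q.
  by apply: cvgM; [exact: cvg_cst|exact: continuous_residual].
apply/funext => p; rewrite /correlation mxE mxE; congr (_ * _).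
by apply: eq_bigr => i _; rewrite mxE.
Qed.

Lemma continuous_l1norm (n M : nat) :
  continuous (fun p : 'cV[R]_n * 'cV[R]_M => l1norm p.2).
Proof.
apply: (@continuous_sum R _ _ (fun j (p : 'cV[R]_n * 'cV[R]_M) => `|p.2 j ord0|)).
move=> j p; apply: (@continuous_comp _ _ _ (fun p : 'cV[R]_n * 'cV[R]_M => p.2 j ord0)
  (fun x : R => `|x|)); first exact: continuous_snd_coord.
exact: norm_continuous.
Qed.

Lemma continuous_lasso_objective (n M : nat) (X : 'M[R]_(n, M)) (r : R) :
  continuous (fun p : 'cV[R]_n * 'cV[R]_M =>
    n%:R^-1 * sqnorm (p.1 - X *m p.2) + 2 * r * l1norm p.2).
Proof.
move=> p; apply: cvgD; apply: cvgM; try exact: cvg_cst.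
  apply: (@continuous_sum R _ _ (fun i (p : 'cV[R]_n * 'cV[R]_M) =>
    (p.1 - X *m p.2) i ord0 ^+ 2)) => i q.
  under eq_fun do rewrite expr2.
  by apply: cvgM; exact: continuous_residual.
exact: continuous_l1norm.
Qed.

Lemma l1norm_coord_le (M : nat) (theta : 'cV[R]_M) j :
  `|theta j ord0| <= l1norm theta.
Proof. by rewrite /l1norm (bigD1 j)//= lerDl sumr_ge0. Qed.

Lemma dantzigE (n M : nat) (X : 'M[R]_(n, M)) (Y : 'cV[R]_n) (r : R) : 0 <= r ->
  dantzig X Y r = minimizers
    [set theta | forall j, `|correlation X (Y - X *m theta) j ord0| <= r] (@l1norm R M).
Proof.
move=> r0; rewrite /dantzig; congr minimizers; last first.
  by apply/funext => theta; rewrite lpnorm1E.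
by apply/seteqP; split => theta /= /cV_norm_leP => /(_ r0).
Qed.

Lemma measurable_solutions_avoid (d : measure_display)
    (Omega : measurableType d) (n M : nat) (X : 'M[R]_(n, M))
    (Y : Omega -> 'cV[R]_n) (e : estimator) (r : R) (G : set 'cV[R]_M) :
  (forall i, measurable_fun setT (fun w => Y w i ord0)) -> 0 < r -> closed G ->
  measurable [set w | forall theta, solutions e X (Y w) r theta -> ~ G theta].
Proof.
move=> mY r0 cG; have mYO := measurable_cV_preimage mY.
case: e => /=.
  rewrite (_ : [set w | _] = [set w | forall theta, minimizers
     [set u | ([set: 'cV[R]_n * 'cV[R]_M]) (Y w, u)]
     (fun u => n%:R^-1 * sqnorm ((Y w, u).1 - X *m (Y w, u).2)
        + 2 * r * l1norm (Y w, u).2) theta -> ~ G theta]); last first.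
    apply/seteqP; split => w /= h theta.
      by move=> [_ min]; apply: h; apply/lasso_min => eta; exact: min.
    by move=> /lasso_min min; apply: h; split => // eta _; exact: min.
  apply: (measurable_no_minimizer closedT
    (@continuous_lasso_objective n M X r) _ mYO cG) => q.
  (* The quadratic term being nonnegative, the penalty alone gives [2 r |theta_j| <= q], whatever
     the data [y]. *)
  exists [set z : 'cV[R]_M | forall j, `|z j ord0| <= q / (2 * r)].
    exact: compact_cV_box.
  move=> y theta _ /= le_q j; rewrite ler_pdivlMr; last by rewrite mulr_gt0.
  have : 0 <= n%:R^-1 * sqnorm (y - X *m theta).
    by rewrite mulr_ge0// sumr_ge0// => i _; rewrite sqr_ge0.
  have r20 : 0 <= 2 * r by lra.
  by have := ler_wpM2l r20 (l1norm_coord_le theta j); lra.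
(* The Dantzig constraint moves with the data, so it enters as a closed subset of the product
   space. *)
pose D := [set p : 'cV[R]_n * 'cV[R]_M |
  forall j, `|correlation X (p.1 - X *m p.2) j ord0| <= r].
under eq_set => w do rewrite (dantzigE X (Y w) (ltW r0)).
have closedD : closed D.
  rewrite (_ : D = \bigcap_(j : 'I_M) ((fun p : 'cV[R]_n * 'cV[R]_M =>
      `|correlation X (p.1 - X *m p.2) j ord0|) @^-1` [set x | x <= r])).
    apply: closed_bigI => j _; apply: closed_comp => // p _.
    apply: (@continuous_comp _ _ _ (fun p : 'cV[R]_n * 'cV[R]_M =>
      correlation X (p.1 - X *m p.2) j ord0) (fun x : R => `|x|)).
      exact: continuous_correlation.
    exact: norm_continuous.
  by apply/seteqP; split => p /= h j => [_|]; exact: h.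
apply: (measurable_no_minimizer closedD (@continuous_l1norm n M) _ mYO cG) => q.
exists [set z : 'cV[R]_M | forall j, `|z j ord0| <= q].
  exact: compact_cV_box.
by move=> y theta _ /= le_q j; rewrite (le_trans (l1norm_coord_le theta j)).
Qed.

Lemma sup_loss_le (M : nat) (S : set 'cV[R]_M) (thetas : 'cV[R]_M) (c : R) :
  (sup_loss S thetas <= c%:E)%E <->
  forall theta, S theta -> `|theta - thetas| <= c.
Proof.
split => [h theta Stheta|h].
  rewrite -lee_fin; apply: le_trans h; apply: ereal_sup_ubound.
  by exists theta.
by apply: ge_ereal_sup => _ [theta Stheta <-]; rewrite lee_fin h.
Qed.

(** The vectors at distance more than [c] form an open set, while avoidance is measurable for closed
    sets; this open set is the union of the closed sets [G k], each of which has to be avoided. *)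
Lemma measurable_sup_loss_le (d : measure_display)
    (Omega : measurableType d) (n M : nat) (X : 'M[R]_(n, M))
    (thetas : 'cV[R]_M) (Y : Omega -> 'cV[R]_n) (e : estimator) (r c : R) :
  (forall i, measurable_fun setT (fun w => Y w i ord0)) -> 0 < r -> 0 <= c ->
  measurable [set w | (sup_loss (solutions e X (Y w) r) thetas <= c%:E)%E].
Proof.
move=> mY r0 c0.
pose G k := [set theta : 'cV[R]_M | c + k.+1%:R^-1 <= `|theta - thetas|].
have cG k : closed (G k).
  rewrite (_ : G k = ~` ball thetas (c + k.+1%:R^-1)).
    by rewrite -openC setCK; apply: ball_open; rewrite ltr_wpDl ?invr_gt0.
  apply/seteqP; split => theta; rewrite /G -ball_normE /ball_/= distrC.
    by move=> h; apply/negP; rewrite -leNgt.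
  by move=> /negP; rewrite -leNgt.
rewrite (_ : [set w | _] = \bigcap_k [set w | forall theta,
    solutions e X (Y w) r theta -> ~ G k theta]).
  by apply: bigcapT_measurable => k; exact: measurable_solutions_avoid.
apply/seteqP; split => w /=.
  move=> /sup_loss_le h k _ theta /h le_c; rewrite /G/= => le_k.
  have := le_trans le_k le_c.
  by rewrite leNgt ltrDl invr_gt0 ltr0n.
move=> h; apply/sup_loss_le => theta sol; rewrite leNgt; apply/negP => lt_c.
have /ltr_add_invr[k lt_k] := lt_c.
by apply: (h k I theta sol); rewrite /G/= ltW.
Qed.

End EventMeasurability.

(** * Affine images and densities of normal laws *)

Section NormalLaw.
Context {R : realType}.
Local Notation mu := (@lebesgue_measure R).

Lemma measurable_affine (a b : R) :
  measurable_fun [set: measurableTypeR R]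
    (fun x => a * x + b : measurableTypeR R).
Proof. by apply: measurable_funD => //; apply: measurable_funM. Qed.

(** By uniqueness of Lebesgue measure it suffices to compare with the rescaled pushforward on
    half-open intervals. *)
Lemma lebesgue_measure_affine (a b : R) (A : set R) : a != 0 -> measurable A ->
  mu A = (`|a|%:E * mu [set x | A (a * x + b)%R])%E.
Proof.
move=> a0 mA.
pose phi (x : measurableTypeR R) : measurableTypeR R := a * x + b.
have mphi : measurable_fun setT phi := @measurable_affine a b.
pose nu : {measure set (measurableTypeR R) -> \bar R} := pushforward mu phi.
pose nu' : {measure set (measurableTypeR R) -> \bar R} :=
  mscale (NngNum (normr_ge0 a)) (nu mphi).
suff /lebesgue_measure_unique/(_ A mA) : forall X, ocitv X -> mu X = nu' X by [].
move=> _ [[u v] _ <-].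
transitivity (`|a|%:E * mu (phi @^-1` `]u, v]%classic))%E; last by [].
have [agt0|agt0] := boolP (0 < a).
  rewrite (_ : phi @^-1` _ = `](u - b) / a, (v - b) / a]%classic).
    rewrite !lebesgue_measure_itv/= !lte_fin ltr_pM2r ?invr_gt0// ltrD2r.
    case: ifP => _; last by rewrite mule0.
    rewrite -!EFinB -EFinM gtr0_norm//; congr EFin; field.
    by rewrite a0.
  apply/seteqP; split => x /=; rewrite !in_itv/= /phi;
    by rewrite ltr_pdivrMr// ler_pdivlMr// ltrBlDr lerBrDr mulrC.
have alt0 : a < 0 by rewrite lt_neqAle a0 leNgt.
(* A negative slope exchanges the endpoints, so the interval becomes closed on the left. *)
rewrite (_ : phi @^-1` _ = `[(v - b) / a, (u - b) / a[%classic).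
  rewrite !lebesgue_measure_itv/= !lte_fin ltr_nM2r ?invr_lt0// ltrD2r.
  case: ifP => _; last by rewrite mule0.
  rewrite -!EFinB -EFinM ltr0_norm//; congr EFin; field.
  by rewrite a0.
apply/seteqP; split => x /=; rewrite !in_itv/= /phi;
  by rewrite ltr_ndivlMr// ler_ndivrMr// ltrBlDr lerBrDr andbC mulrC.
Qed.

Lemma ge0_integral_affine (a b : R) (f : R -> \bar R) : a != 0 ->
  measurable_fun [set: R] f -> (forall x, 0 <= f x)%E ->
  (\int[mu]_x f x = \int[mu]_x (`|a|%:E * f (a * x + b)%R))%E.
Proof.
move=> a0 mf f0.
pose phi (x : measurableTypeR R) : measurableTypeR R := a * x + b.
have mphi : measurable_fun setT phi := @measurable_affine a b.
pose nu : {measure set (measurableTypeR R) -> \bar R} := pushforward mu phi.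
rewrite (@eq_measure_integral _ _ _ setT
  (mscale (NngNum (normr_ge0 a)) (nu mphi))); last first.
  by move=> A mA _; exact: lebesgue_measure_affine.
rewrite ge0_integral_mscale// ge0_integralZl//.
  by rewrite ge0_integral_pushforward.
exact: (measurableT_comp mf mphi).
Qed.

Lemma normal_pdf_affine (m s a b x : R) : a != 0 -> s != 0 ->
  normal_pdf m s x = `|a| * normal_pdf (a * m + b) (a * s) (a * x + b).
Proof.
move=> a0 s0; rewrite !normal_pdfE ?mulf_neq0// /normal_peak /normal_fun mulrA.
congr (_ * _).
  have -> : (a * s) ^+ 2 * pi *+ 2 = a ^+ 2 * (s ^+ 2 * pi *+ 2) by ring.
  rewrite (sqrtrM _ (sqr_ge0 a)) sqrtr_sqr invfM.
  by rewrite mulrA divff ?normr_eq0// mul1r.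
congr expR; field; by rewrite a0 s0.
Qed.

Lemma normal_probE (m s : R) (A : set R) : measurable A ->
  (normal_prob m s A = \int[mu]_x (normal_pdf m s x * \1_A x)%:E)%E.
Proof.
move=> mA; rewrite /normal_prob integral_mkcond; apply: eq_integral => x _.
rewrite patchE indicE; case: ifPn => /= xA; rewrite ?mulr1 ?mulr0//.
Qed.

Lemma normal_prob_affine (m s a b : R) (B : set R) : a != 0 -> s != 0 ->
  measurable B ->
  normal_prob m s [set x | B (a * x + b)] = normal_prob (a * m + b) (a * s) B.
Proof.
move=> a0 s0 mB; rewrite !normal_probE//; last first.
  by have := @measurable_affine a b measurableT B mB; rewrite setTI.
rewrite [RHS](@ge0_integral_affine a b)//.
- apply: eq_integral => x _.
  rewrite (normal_pdf_affine m b x a0 s0) -EFinM mulrA; congr (_ * _)%:E.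
- apply/measurable_EFinP/measurable_funM; last exact: measurable_indic.
  exact: measurable_normal_pdf.
- by move=> x; rewrite lee_fin mulr_ge0// normal_pdf_ge0.
Qed.

(** Turns the scale [a * s] of an affine image with [a < 0] into [|a| * s]. *)
Lemma normal_prob_opp (m s : R) : normal_prob m (- s) = normal_prob m s.
Proof.
apply/funext => A; apply: eq_integral => x _; congr EFin.
rewrite /normal_pdf oppr_eq0; case: ifP => // _.
by rewrite /normal_peak /normal_fun sqrrN.
Qed.

(** The Radon-Nikodym derivative of the law agrees almost everywhere with the density, as both have
    the same integral over every measurable set. *)
Lemma ge0_integral_normal_prob (m s : R) (f : R -> \bar R) :
  measurable_fun [set: R] f -> (forall x, 0 <= f x)%E ->
  (\int[normal_prob m s]_x f x = \int[mu]_x (f x * (normal_pdf m s x)%:E))%E.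
Proof.
move=> mf f0; have dom := normal_prob_dominates m s.
rewrite -(Radon_Nikodym_SigmaFinite.change_of_variables dom f0 measurableT mf).
have mRN := measurable_int _ (Radon_Nikodym_SigmaFinite.f_integrable dom).
apply: ge0_ae_eq_integral => //.
- exact: emeasurable_funM.
- apply: emeasurable_funM => //.
  by apply/measurable_EFinP; exact: measurable_normal_pdf.
- by move=> x _; rewrite mule_ge0//; exact: Radon_Nikodym_SigmaFinite.f_ge0.
- by move=> x _; rewrite mule_ge0// lee_fin normal_pdf_ge0.
apply: ae_eqe_mul2l; apply: integral_ae_eq => //.
- exact: Radon_Nikodym_SigmaFinite.f_integrable.
- by apply/measurable_EFinP; exact: measurable_normal_pdf.
- by move=> E _ mE; rewrite -Radon_Nikodym_SigmaFinite.f_integral.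
Qed.

End NormalLaw.

(** * Convolution and tails of centered normal laws *)

Section NormalConvolution.
Context {R : realType}.
Local Notation mu := (@lebesgue_measure R).

Lemma measurable_normal_pdf2 (s : R) : s != 0 ->
  measurable_fun [set: measurableTypeR R * measurableTypeR R]
    (fun p => normal_pdf p.1 s p.2).
Proof.
move=> s0; under eq_fun do rewrite normal_pdfE//.
apply: measurable_funM => //; apply: measurableT_comp => //.
apply: measurable_funM => //; apply: measurableT_comp => //.
by apply: measurable_funX; apply: measurable_funB.
Qed.

(** Completing the square: the joint density of a normal variable [x] and its noisy copy [y] factors
    into the marginal density of [y] and the conditional density of [x] given [y]. *)
Lemma normal_pdf_mul (s1 s2 x y : R) : 0 < s1 -> 0 < s2 ->
  let s := Num.sqrt (s1 ^+ 2 + s2 ^+ 2) in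
  normal_pdf x s2 y * normal_pdf 0 s1 x
  = normal_pdf 0 s y * normal_pdf (y * s1 ^+ 2 / s ^+ 2) (s1 * s2 / s) x.
Proof.
move=> s10 s20 s; have ss : s ^+ 2 = s1 ^+ 2 + s2 ^+ 2.
  by rewrite sqr_sqrtr// addr_ge0// sqr_ge0.
have s0 : 0 < s by rewrite sqrtr_gt0 addr_gt0// exprn_gt0.
rewrite !normal_pdfE ?gt_eqF ?divr_gt0 ?mulr_gt0//.
rewrite mulrACA [RHS]mulrACA; congr (_ * _).
  rewrite /normal_peak -!invfM -!sqrtrM; last 2 first.
  - by rewrite mulrn_wge0// mulr_ge0 ?sqr_ge0// pi_ge0.
  - by rewrite mulrn_wge0// mulr_ge0 ?sqr_ge0// pi_ge0.
  by congr (_^-1); congr Num.sqrt; field; rewrite gt_eqF.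
rewrite /normal_fun -!expRD; congr expR; rewrite !subr0.
rewrite expr_div_n exprMn ss; field.
by rewrite !gt_eqF// addr_gt0// exprn_gt0.
Qed.

(** After exchanging the integrals, the marginal density of [y] leaves the inner integral, and the
    conditional density of [x] integrates to 1. *)
Lemma normal_convolution (s1 s2 : R) (B : set R) : 0 < s1 -> 0 < s2 ->
  measurable B ->
  (\int[normal_prob 0 s1]_x normal_prob x s2 B
   = normal_prob 0 (Num.sqrt (s1 ^+ 2 + s2 ^+ 2)) B)%E.
Proof.
move=> s10 s20 mB; set s := Num.sqrt _.
pose g (p : measurableTypeR R * measurableTypeR R) :=
  (normal_pdf p.1 s2 p.2 * \1_B p.2)%:E.
have mg : measurable_fun setT g.
  apply/measurable_EFinP/measurable_funM.
    by apply: measurable_normal_pdf2; rewrite gt_eqF.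
  exact: (measurableT_comp (measurable_indic _) measurable_snd).
have g0 p : (0 <= g p)%E by rewrite lee_fin mulr_ge0// normal_pdf_ge0.
have gE x : normal_prob x s2 B = (\int[mu]_y g (x, y))%E by rewrite normal_probE.
have mG : measurable_fun setT (fun x => \int[mu]_y g (x, y))%E.
  exact: (measurable_fun_fubini_tonelli_F g).
under eq_integral do rewrite gE.
rewrite ge0_integral_normal_prob//; last by move=> x; exact: integral_ge0.
pose f (p : measurableTypeR R * measurableTypeR R) :=
  (g p * (normal_pdf 0 s1 p.1)%:E)%E.
have mf : measurable_fun setT f.
  apply: emeasurable_funM => //; apply/measurable_EFinP.
  exact: (measurableT_comp (measurable_normal_pdf _ _) measurable_fst).
have f0 p : (0 <= f p)%E by rewrite mule_ge0// lee_fin normal_pdf_ge0.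
transitivity (\int[mu]_x \int[mu]_y f (x, y))%E.
  apply: eq_integral => x _; rewrite /f/= ge0_integralZr//.
    exact: (measurable_fun_pair2 x mg).
  by rewrite lee_fin normal_pdf_ge0.
rewrite fubini_tonelli// normal_probE//; apply: eq_integral => y _.
transitivity (\int[mu]_x ((normal_pdf 0 s y * \1_B y)%:E
    * (normal_pdf (y * s1 ^+ 2 / s ^+ 2) (s1 * s2 / s) x)%:E))%E.
  apply: eq_integral => x _; rewrite /f /g/= -!EFinM; congr EFin.
  by rewrite mulrAC normal_pdf_mul// mulrAC.
rewrite ge0_integralZl//.
- by rewrite integral_normal_pdf mule1.
- by apply/measurable_EFinP; exact: measurable_normal_pdf.
- by move=> x _; rewrite lee_fin normal_pdf_ge0.
- by rewrite lee_fin mulr_ge0// normal_pdf_ge0.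
Qed.

(* For [x] beyond [m = +-t] the density centered at 0 is at most
   [exp (- t ^ 2 / (2 s ^ 2))] times the density centered at [m], so the two
   one-sided tails are compared with two disjoint half-lines. *)
Lemma normal_tail (s t : R) : 0 < s -> 0 <= t ->
  (normal_prob 0 s [set x : R | (t < `|x|)%R]
   <= (expR (- (t ^+ 2 / (s ^+ 2 *+ 2))))%:E)%E.
Proof.
move=> s0 t0; set c := expR _.
have sn0 : s != 0 by rewrite gt_eqF.
have shift (m : R) (A : set R) : measurable A ->
    normal_prob m s A = normal_prob 0 s [set x | A (1 * x + m)].
  move=> mA; have := normal_prob_affine 0 m (oner_neq0 R) sn0 mA.
  by rewrite mulr0 add0r mul1r => ->.
have pdf_le (m x : R) : 0 <= m * (x - m) -> m ^+ 2 = t ^+ 2 ->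
    normal_pdf 0 s x <= c * normal_pdf m s x.
  move=> mx mt; rewrite !normal_pdfE// mulrCA ler_wpM2l ?normal_peak_ge0//.
  rewrite /normal_fun /c -expRD ler_expR subr0.
  rewrite -mt; set v := (s ^+ 2 *+ 2)^-1.
  have v0 : 0 <= v by rewrite invr_ge0 mulrn_wge0 ?sqr_ge0.
  (* Uses [x ^ 2 = (x - m) ^ 2 + m ^ 2 + 2 m (x - m)], whose last term is nonnegative. *)
  by have := mulr_ge0 v0 mx; lra.
have prob_le (m : R) (A : set R) : measurable A -> m ^+ 2 = t ^+ 2 ->
    (forall x, A x -> 0 <= m * (x - m)) ->
    (normal_prob 0 s A <= c%:E * normal_prob m s A)%E.
  move=> mA mt Am; rewrite /normal_prob -ge0_integralZl//.
  - apply: ge0_le_integral => //.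
    + by move=> x _; rewrite lee_fin normal_pdf_ge0.
    + by apply/measurable_EFinP/measurable_funTS; exact: measurable_normal_pdf.
    + apply: emeasurable_funM => //.
      by apply/measurable_EFinP/measurable_funTS; exact: measurable_normal_pdf.
    + by move=> x /Am mx; rewrite -EFinM lee_fin pdf_le.
  - by apply/measurable_EFinP/measurable_funTS; exact: measurable_normal_pdf.
  - by move=> x _; rewrite lee_fin normal_pdf_ge0.
  - by rewrite lee_fin expR_ge0.
pose Ap := `]t, +oo[%classic : set R; pose An := `]-oo, - t[%classic : set R.
have mAp : measurable Ap by exact: measurable_itv.
have mAn : measurable An by exact: measurable_itv.
pose Bp := `]0, +oo[%classic : set R; pose Bn := `]-oo, 0[%classic : set R.
have mBp : measurable Bp by exact: measurable_itv.
have mBn : measurable Bn by exact: measurable_itv.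
rewrite (_ : [set x | _] = Ap `|` An); last first.
  apply/seteqP; split => x /=; rewrite /Ap /An/= !in_itv/= andbT.
    by rewrite lter_normr => /orP[|]; [left|right; rewrite ltrNr].
  by case=> h; rewrite lter_normr ?h// ltrNr h orbT.
have Apn0 : Ap `&` An = set0.
  by apply/seteqP; split => x //=; rewrite /Ap /An/= !in_itv/= andbT => -[]; lra.
have Bpn0 : Bp `&` Bn = set0.
  by apply/seteqP; split => x //=; rewrite /Bp /Bn/= !in_itv/= andbT => -[]; lra.
rewrite measureU//.
apply: (@le_trans _ _ (c%:E * normal_prob t s Ap + c%:E * normal_prob (- t) s An)%E).
  apply: leeD; apply: prob_le => //.
  - by move=> x; rewrite /Ap/= in_itv/= andbT => tx; rewrite mulr_ge0// subr_ge0 ltW.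
  - by rewrite sqrrN.
  - move=> x; rewrite /An/= in_itv/= => tx; rewrite mulr_le0 ?oppr_le0// opprK; lra.
rewrite -ge0_muleDr//.
(* Recentering moves both tails to half-lines starting at 0. *)
rewrite (shift t)// (shift (- t))//.
rewrite (_ : [set x | Ap (1 * x + t)] = Bp); last first.
  by apply/seteqP; split => x; rewrite /Ap /Bp/= !in_itv/= !andbT; lra.
rewrite (_ : [set x | An (1 * x - t)] = Bn); last first.
  by apply/seteqP; split => x /=; rewrite /An /Bn/= !in_itv/=; lra.
(* Disjointness bounds the total mass by 1, which avoids the factor 2. *)
rewrite -measureU// -[leRHS]mule1 lee_wpmul2l ?lee_fin ?expR_ge0//.
by apply: probability_le1; exact: measurableU.
Qed.

End NormalConvolution.

(** * Law of a linear combination of independent centered normal variables *)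

Section GaussianSums.
Context {R : realType}.

(* [normal_prob 0 0] is a uniform law in the library, hence the Dirac mass. *)
Definition centered_normal (s : R) : probability (measurableTypeR R) R :=
  if s == 0 then (dirac (0 : measurableTypeR R) : probability _ R)
  else (normal_prob 0 s : probability _ R).

Lemma measurable_normal_prob_mean (s : R) (B : set R) : s != 0 -> measurable B ->
  measurable_fun [set: measurableTypeR R] (fun m => normal_prob m s B).
Proof.
move=> s0 mB.
pose g (p : measurableTypeR R * measurableTypeR R) :=
  (normal_pdf p.1 s p.2 * \1_B p.2)%:E.
have mg : measurable_fun setT g.
  apply/measurable_EFinP/measurable_funM; first exact: measurable_normal_pdf2.
  exact: (measurableT_comp (measurable_indic _) measurable_snd).
have g0 p : (0 <= g p)%E by rewrite lee_fin mulr_ge0// normal_pdf_ge0.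
rewrite (_ : (fun _ => _) = (fun m => \int[lebesgue_measure]_y g (m, y))%E).
  exact: (measurable_fun_fubini_tonelli_F g).
by apply/funext => m; rewrite normal_probE.
Qed.

(** For [a != 0] the section over a first component [x] has the mass of a normal law with mean [x],
    so the product measure integrates to a convolution; for [a = 0] the second component drops
    out. *)
Lemma centered_normal_add (s a sigma : R) (B : set R) :
  0 <= s -> 0 < sigma -> measurable B ->
  ((centered_normal s \x normal_prob 0 sigma)%E
     [set p : measurableTypeR R * measurableTypeR R | B (a * p.2 + p.1)])
  = centered_normal (Num.sqrt (s ^+ 2 + (a * sigma) ^+ 2)) B.
Proof.
move=> s0 sigma0 mB; have [->|a0] := eqVneq a 0.
  rewrite (_ : [set p | _] = B `*` setT); last first.
    by apply/seteqP; split => p /=; rewrite mul0r add0r => // -[].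
  rewrite product_measure1E//.
  rewrite mul0r expr0n/= addr0 sqrtr_sqr ger0_norm//.
  by rewrite [normal_prob 0 sigma _]probability_setT mule1.
have as0 : `|a| * sigma != 0 by rewrite mulf_neq0 ?normr_eq0// gt_eqF.
have as_ge0 : 0 <= `|a| * sigma by rewrite mulr_ge0// ltW.
have sectE x : normal_prob 0 sigma
    (xsection [set p : measurableTypeR R * measurableTypeR R | B (a * p.2 + p.1)] x)
    = normal_prob x (`|a| * sigma) B.
  rewrite (_ : xsection _ _ = [set y | B (a * y + x)]); last first.
    by apply/seteqP; split => y; rewrite xsectionE.
  have sigman0 : sigma != 0 by rewrite gt_eqF.
  have -> := normal_prob_affine 0 x a0 sigman0 mB; rewrite mulr0 add0r.
  have [a_ge0|a_lt0] := ger0P a; first by [].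
  by rewrite mulNr normal_prob_opp.
rewrite /product_measure1; under eq_integral do rewrite /= sectE.
have -> : Num.sqrt (s ^+ 2 + (a * sigma) ^+ 2)
    = Num.sqrt (s ^+ 2 + (`|a| * sigma) ^+ 2).
  by rewrite !exprMn real_normK ?num_real.
have sq_gt0 : 0 < (`|a| * sigma) ^+ 2 by rewrite exprn_even_gt0.
(* For [s = 0] the Dirac mass evaluates the sections at 0; otherwise two genuine normal laws are
   convolved. *)
rewrite /centered_normal; have [->|sn0] := eqVneq s 0.
  rewrite expr0n/= add0r sqrtr_sqr normr_eq0 (negbTE as0).
  rewrite integral_dirac//; last exact: measurable_normal_prob_mean.
  by rewrite diracT mul1e (ger0_norm as_ge0).
rewrite sqrtr_eq0 leNgt ltr_wpDl ?sqr_ge0//=.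
rewrite normal_convolution// ?lt_def ?sn0//.
by rewrite as0.
Qed.

(** Product measures are determined by rectangles. The factor [P G] is put on [mu] rather than
    divided out, so a null event [G] is covered. *)
Lemma joint_law (d : measure_display) (Omega : measurableType d)
    (P : probability Omega R) (X Z : Omega -> measurableTypeR R) (G : set Omega)
    (mu nu : probability (measurableTypeR R) R) :
  measurable_fun setT X -> measurable_fun setT Z -> measurable G ->
  (forall A B, measurable A -> measurable B ->
    P ((X @^-1` A) `&` (Z @^-1` B) `&` G) = mu A * nu B * P G)%E ->
  forall E, measurable E ->
    P ([set w | E (X w, Z w)] `&` G) = ((mu \x nu) E * P G)%E.
Proof.
move=> mX mZ mG PE E mE.
have mXZ : measurable_fun setT (fun w => (X w, Z w)) by exact: measurable_fun_pair.
pose m' : {measure set (measurableTypeR R * measurableTypeR R) -> \bar R} :=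
  pushforward (mrestr P mG) (fun w => (X w, Z w)).
have PGfin : P G \is a fin_num by exact: fin_num_measure.
pose c : {nonneg R} := NngNum (fine_ge0 (measure_ge0 P G)).
have := @product_measure_unique _ _ _ _ R (mscale c mu) nu (m' mXZ).
move=> /(_ _ E mE) h.
transitivity (m' mXZ E); first reflexivity.
rewrite -h => [|A B mA mB].
  rewrite /product_measure1 ge0_integral_mscale//=.
    by rewrite fineK// muleC.
  exact: measurable_fun_xsection.
rewrite /= /mscale/= fineK//.
transitivity (P ((X @^-1` A) `&` (Z @^-1` B) `&` G)); first reflexivity.
by rewrite PE// muleC muleA.
Qed.

(* The variables outside [s] are carried along so that, at each step, the partial
   sum and the next variable form an independent pair jointly with them. *)
Lemma independent_sum_law (d : measure_display) (Omega : measurableType d)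
    (P : probability Omega R) (n : nat) (sigma : R) (W : 'I_n -> {RV P >-> R})
    (a : 'I_n -> R) :
  0 < sigma -> mutually_independent W -> (forall i, gaussian_law 0 sigma (W i)) ->
  forall (s : seq 'I_n) (K : {set 'I_n}) (B : set R) (C : 'I_n -> set R),
  uniq s -> (forall i, i \in s -> i \notin K) ->
  measurable B -> (forall i, measurable (C i)) ->
  P ([set w | B (\sum_(i <- s) a i * W i w)]
      `&` \bigcap_(i in [set` K]) (W i @^-1` C i))
  = (centered_normal (sigma * Num.sqrt (\sum_(i <- s) a i ^+ 2)) B
     * P (\bigcap_(i in [set` K]) (W i @^-1` C i)))%E.
Proof.
move=> sigma0 indep law.
have mW i (D : set R) : measurable D -> measurable (W i @^-1` D).
  by move=> mD; rewrite -[X in measurable X]setTI; exact: measurable_funP.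
have mcap (K : {set 'I_n}) (C : 'I_n -> set R) : (forall i, measurable (C i)) ->
    measurable (\bigcap_(i in [set` K]) (W i @^-1` C i)).
  move=> mC; apply: fin_bigcap_measurable => [|i _]; last exact: mW.
  exact: finite_finset.
have msum (s : seq 'I_n) : measurable_fun setT
    (fun w => \sum_(i <- s) a i * W i w : measurableTypeR R).
  apply: measurable_sum => i; apply: measurable_funM => //.
elim=> [|i s IH] K B C /=.
  (* The empty sum has law [centered_normal 0], the Dirac mass at 0. *)
  move=> _ _ mB mC; rewrite !big_nil sqrtr0 mulr0 /centered_normal eqxx.
  under eq_set do rewrite big_nil.
  rewrite /= diracE; have [B0|B0] := boolP (0 \in B).
    rewrite mul1e; congr (P _); rewrite (_ : [set _ | _] = setT) ?setTI//.
    by apply/seteqP; split => // w _; exact: set_mem.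
  rewrite mul0e (_ : [set _ | _] = set0) ?set0I ?measure0//.
  by apply/seteqP; split => // w /= B00; move: B0; rewrite mem_set.
move=> /andP[i_notin_s uniq_s] disj mB mC.
have iK : i \notin K by apply: disj; rewrite mem_head.
set G := \bigcap_(j in [set` K]) _.
have joint (A D : set (measurableTypeR R)) : measurable A -> measurable D ->
    P (((fun w => \sum_(j <- s) a j * W j w) @^-1` A) `&` (W i @^-1` D) `&` G)
    = (centered_normal (sigma * Num.sqrt (\sum_(j <- s) a j ^+ 2))%R A
      * normal_prob 0 sigma D * P G)%E.
  move=> mA mD.
  (* Adjoining [i] to the carried set, with constraint [D], brings the event under the induction
     hypothesis; independence then splits [W i] off again. *)
  pose C' j := if j == i then D else C j.
  have mC' j : measurable (C' j) by rewrite /C'; case: ifP => _; [exact: mD|exact: mC].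
  have capE : \bigcap_(j in [set` i |: K]%SET) (W j @^-1` C' j) = W i @^-1` D `&` G.
    apply/seteqP; split => w /=.
      move=> h; split.
        by have := h i; rewrite /= !inE eqxx /C' eqxx; exact.
      move=> j /= jK; have := h j; rewrite /= !inE jK orbT /C'.
      by case: eqVneq => [ji|_]; [move: iK; rewrite -ji jK|exact].
    move=> [Di h] j /=; rewrite !inE /C' => /orP[/eqP->|jK]; first by rewrite eqxx.
    case: eqVneq => [->//|_]; exact: h.
  rewrite -setIA -capE (IH _ A C')//; last first.
    move=> j js; rewrite !inE negb_or disj ?inE ?js ?orbT// andbT.
    by apply: contraNneq i_notin_s => <-.
  rewrite -muleA; congr (_ * _)%E.
  rewrite indep; last by move=> j _; exact: mC'.
  rewrite (@big_setU1 _ _ _ _ i K _ iK)/= -(law i D mD).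
  rewrite {1}/C' eqxx; congr (_ * _)%E.
  rewrite /G indep//; apply: eq_bigr => j jK.
  by rewrite /C'; case: eqVneq => // ji; move: iK; rewrite -ji jK.
pose E := [set p : measurableTypeR R * measurableTypeR R | B (a i * p.2 + p.1)].
have mE : measurable E.
  have mf : measurable_fun [set: measurableTypeR R * measurableTypeR R]
      (fun p => a i * p.2 + p.1 : measurableTypeR R).
    by apply: measurable_funD => //; exact: measurable_funM.
  by have := mf measurableT B mB; rewrite setTI.
have -> : [set w | B (\sum_(j <- i :: s) a j * W j w)]
    = [set w | E (\sum_(j <- s) a j * W j w, W i w)].
  by apply/seteqP; split => w; rewrite /E/= big_cons.
rewrite (joint_law (msum s) (measurable_funPT (W i)) (mcap K C mC) joint mE).
have s0 : 0 <= sigma * Num.sqrt (\sum_(j <- s) a j ^+ 2).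
  by rewrite mulr_ge0 ?sqrtr_ge0// ltW.
have -> := centered_normal_add (a i) s0 sigma0 mB.
congr (centered_normal _ B * _)%E; rewrite big_cons.
have sum_ge0 : 0 <= \sum_(j <- s) a j ^+ 2 by apply: sumr_ge0 => j _; exact: sqr_ge0.
rewrite !exprMn sqr_sqrtr// mulrC -mulrDl addrC.
by rewrite sqrtrM ?addr_ge0 ?sqr_ge0// sqrtr_sqr gtr0_norm// mulrC.
Qed.

End GaussianSums.

(** * Union bound and tail of the noise correlations *)

Section UnionBound.
Context {R : realType}.

Lemma measure_bigsetU_le (d : measure_display) (T : measurableType d)
    (P : {measure set T -> \bar R}) (I : Type) (s : seq I) (F : I -> set T) :
  (forall i, measurable (F i)) ->
  (P (\big[setU/set0]_(i <- s) F i) <= \sum_(i <- s) P (F i))%E.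
Proof.
move=> mF; elim: s => [|i s IH]; first by rewrite !big_nil measure0.
rewrite !big_cons (le_trans (measureU2 _ _ _))//.
  exact: bigsetU_measurable.
by rewrite leeD2l.
Qed.

Lemma correlationE (n M : nat) (X : 'M[R]_(n, M)) (u : 'cV[R]_n) (j : 'I_M) :
  correlation X u j ord0 = \sum_i n%:R^-1 * X i j * u i ord0.
Proof.
rewrite /correlation mxE mxE mulr_sumr; apply: eq_bigr => i _.
by rewrite mxE mulrA.
Qed.

Lemma noise_tail (d : measure_display) (Omega : measurableType d)
    (P : probability Omega R) (n M : nat) (sigma t : R) (W : 'I_n -> {RV P >-> R})
    (X : 'M[R]_(n, M)) (j : 'I_M) :
  (1 <= n)%N -> 0 < sigma -> 0 <= t -> mutually_independent W ->
  (forall i, gaussian_law 0 sigma (W i)) -> gram X j j = 1 ->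
  (P [set w | (t < `|correlation X (\col_i W i w) j ord0|)%R]
   <= (expR (- (n%:R * t ^+ 2 / (2 * sigma ^+ 2))))%:E)%E.
Proof.
move=> n1 sigma0 t0 indep law diag1.
have n0 : 0 < n%:R :> R by rewrite ltr0n.
pose a i := n%:R^-1 * X i j.
pose B := [set x : R | t < `|x|].
have mB : measurable B.
  rewrite (_ : B = Num.norm @^-1` `]t, +oo[%classic).
    by rewrite -[X in measurable X]setTI; exact: normr_measurable.
  by apply/seteqP; split => x; rewrite /B/= in_itv/= andbT.
(* With nothing carried along, the intersection is the whole space and the law of the sum alone
   remains. *)
have := @independent_sum_law R _ _ P n sigma W a sigma0 indep law
  (index_enum 'I_n) finset.set0 B (fun=> setT) (index_enum_uniq _) _ mB _.
(* The sum is [Psi_jj / n], and the diagonal of [Psi] is 1. *)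
have varE : \sum_i a i ^+ 2 = n%:R^-1.
  under eq_bigr do rewrite exprMn.
  by rewrite -mulr_sumr expr2 -mulrA -gram_diagE diag1 mulr1.
rewrite varE (_ : \bigcap_(i in [set` finset.set0]) _ = setT); last first.
  by apply/seteqP; split => // w _ i /=; rewrite inE.
rewrite setIT probability_setT mule1 => lawE.
rewrite (_ : [set w | _] = [set w | B (\sum_i a i * W i w)]); last first.
  apply/funext => w; rewrite /B/= correlationE; congr (_ < `|_|).
  by apply: eq_bigr => i _; rewrite mxE.
rewrite lawE => [|i _|//]; last by rewrite inE.
rewrite /centered_normal ifF; last first.
  by rewrite gt_eqF// mulr_gt0// sqrtr_gt0 invr_gt0.
rewrite (le_trans (normal_tail _ _))//.
  by rewrite mulr_gt0// sqrtr_gt0 invr_gt0.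
rewrite lee_fin le_eqVlt; apply/orP; left; apply/eqP; congr expR.
rewrite exprMn sqr_sqrtr ?invr_ge0 ?ltW//; field.
by rewrite !gt_eqF.
Qed.

End UnionBound.

Theorem theorem1 (R : realType) (d : measure_display) (Omega : measurableType d)
    (P : probability Omega R) (n M : nat) (n_ge1 : (1 <= n)%N) (M_ge2 : (2 <= M)%N)
    (sigma : R) (sigma_gt0 : 0 < sigma)
    (X : 'M[R]_(n, M)) (thetas : 'cV[R]_M)
    (W : 'I_n -> {RV P >-> R})
    (W_indep : mutually_independent W)
    (W_law : forall i, gaussian_law 0 sigma (W i))
    (Y : Omega -> 'cV[R]_n)
    (Y_model : forall w, Y w = X *m thetas + \col_i W i w)
    (e : estimator) (A : R) (A_gt : 2 * Num.sqrt 2 < A)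
    (alpha : R) (alpha_gt1 : 1 < alpha) (s : nat) (s_ge1 : (1 <= s)%N) :
  let r := A * sigma * Num.sqrt (ln M%:R / n%:R) in
  let c0 : R := cone_const R e in
  let c2 := 3 / 2 * (1 + (1 + c0) ^+ 2 / ((1 + 2 * c0) * (alpha - 1))) in
  (forall j, gram X j j = 1) ->
  max_offdiag (gram X) <= 1 / (alpha * (1 + 2 * c0) * s%:R) ->
  (nb_nonzero thetas <= s)%N ->
  ((1 - M%:R `^ (1 - A ^+ 2 / 8))%:E <=
   P [set w | (sup_loss (solutions e X (Y w) r) thetas <= (c2 * r)%:E)%E])%E.
Proof.
move=> r c0 c2 diag1 offdiag sparse.
have A0 : 0 < A by rewrite (le_lt_trans _ A_gt)// mulr_ge0// sqrtr_ge0.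
have n0 : 0 < n%:R :> R by rewrite ltr0n.
have M1 : 1 < M%:R :> R by rewrite ltr1n.
have M0 : 0 < M%:R :> R by rewrite (lt_trans _ M1).
have lnM0 : 0 < ln M%:R :> R by rewrite ln_gt0.
have r0 : 0 < r by rewrite !mulr_gt0// sqrtr_gt0 divr_gt0.
have c00 : 1 <= c0 by rewrite /c0; case: (e) => /=; lra.
have c2r0 : 0 <= c2 * r.
  apply: mulr_ge0; last exact: ltW.
  apply: mulr_ge0; first lra.
  apply: addr_ge0 => //; apply: divr_ge0; first exact: sqr_ge0.
  by apply: mulr_ge0; lra.
have mY i : measurable_fun setT (fun w => Y w i ord0).
  rewrite (_ : (fun _ => _) = (fun w => (X *m thetas) i ord0 + W i w)).
    exact: measurable_funD.
  by apply/funext => w; rewrite Y_model !mxE.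
pose bad j := [set w | r / 2 < `|correlation X (\col_i W i w) j ord0|].
have mbad j : measurable (bad j).
  pose f w := correlation X (\col_i W i w) j ord0.
  have mf : measurable_fun setT f.
    rewrite (_ : f = fun w => \sum_i n%:R^-1 * X i j * W i w).
      by apply: measurable_sum => i; exact: measurable_funM.
    apply/funext => w; rewrite /f correlationE.
    by apply: eq_bigr => i _; rewrite mxE.
  rewrite (_ : bad j = (fun w => `|f w|) @^-1` `]r / 2, +oo[%classic).
    rewrite -[X in measurable X]setTI.
    by apply: (measurableT_comp (@normr_measurable R setT) mf).
  by apply/seteqP; split => w; rewrite /bad/= in_itv/= andbT.
have Pbad j : (P (bad j) <= (M%:R `^ (- (A ^+ 2 / 8)))%:E)%E.
  have r20 : 0 <= r / 2 by rewrite divr_ge0// ltW.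
  rewrite (le_trans (noise_tail n_ge1 sigma_gt0 r20 W_indep W_law (diag1 j)))//.
  (* The choice of [r] makes [n (r / 2) ^ 2 / (2 sigma ^ 2)] equal to [A ^ 2 ln M / 8]. *)
  rewrite lee_fin /powR gt_eqF// ler_expR le_eqVlt; apply/orP; left; apply/eqP.
  rewrite /r !exprMn sqr_sqrtr; last by rewrite divr_ge0// ltW.
  by field; rewrite !gt_eqF.
pose B := \big[setU/set0]_(j < M) bad j.
have mB : measurable B by exact: bigsetU_measurable.
have PB : (P B <= (M%:R `^ (1 - A ^+ 2 / 8))%:E)%E.
  rewrite (le_trans (measure_bigsetU_le _ _ mbad))//.
  rewrite (le_trans (lee_sum _ (fun j _ => Pbad j)))//.
  rewrite sumEFin lee_fin sumr_const card_ord -[leLHS]mulr_natl.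
  (* The factor [M] from the union bound raises the exponent by 1. *)
  rewrite powRD; last by apply/implyP => _; rewrite gt_eqF.
  by rewrite powRr1 // ltW.
apply: (@le_trans _ _ (P (~` B))).
  by rewrite probability_setC// EFinB leeB.
(* Off [B] all noise correlations are at most [r / 2], so the complement of [B] lies in the event;
   both sets must be measurable to compare their probabilities. *)
apply: le_measure; rewrite ?inE.
- exact: measurableC.
- exact: measurable_sup_loss_le.
move=> w nB /=; apply/sup_loss_le => theta; rewrite Y_model => sol.
apply: (solutions_close r0 alpha_gt1 s_ge1 diag1 offdiag sparse _ sol) => j.
rewrite leNgt; apply/negP => badj; apply: nB.
by rewrite /B -bigcup_seq; exists j => //=; rewrite mem_index_enum.
Qed.
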